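(* Let $n\ge 2$, let $c>0$ and let $f:G\to fG$ be a homeomorphism, where $G$ and $fG$ are proper subdomains of $\mathbb{R}^n$. Suppose that there exists $L\geq 1$ such that for all $x,y\in G$ $$h_{G,c}(x,y)/L\leq h_{fG,c}(f(x),f(y))\leq L\,h_{G,c}(x,y).$$ Then $f$ is quasiconformal with linear dilatation $H(f)\leq L^2$.
   Context: For a domain $G\subsetneq\mathbb{R}^n$ and $c>0$, put $d_G(x)=\operatorname{dist}(x,\partial G)$ (Euclidean distance) and $$h_{G,c}(x,y)=\log\left(1+c\,\frac{|x-y|}{\sqrt{d_G(x)d_G(y)}}\right),\qquad x,y\in G.$$ For a homeomorphism $f:G\to fG$ and $z\in G$, the linear dilatation at $z$ is $$H(f,z)=\limsup_{|x-z|=|y-z|=r\to 0^+}\frac{|f(x)-f(z)|}{|f(y)-f(z)|},$$ and $H(f)=\sup_{z\in G}H(f,z)$. By the metric definition, $f$ is quasiconformal if $H(f,z)$ is bounded on $G$, i.e. $H(f)<\infty$. *)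

(* Defs.v *)
From mathcomp Require Import all_boot all_order all_algebra.
From mathcomp Require Import all_classical all_reals all_analysis.

Set Implicit Arguments.
Unset Strict Implicit.
Unset Printing Implicit Defensive.

Import Order.TTheory GRing.Theory Num.Theory.
Import numFieldNormedType.Exports.

Local Open Scope classical_set_scope.
Local Open Scope ring_scope.

(* The library norm on ['rV[R]_n] is the sup norm. It induces the Euclidean
   topology, so the topological notions are the library's, but distances have
   to be measured with the Euclidean norm. *)
Definition enorm (R : realType) (n : nat) (x : 'rV[R]_n) : R :=
  Num.sqrt (\sum_(i < n) x ord0 i ^+ 2).

Definition domain (R : realType) (n : nat) (G : set 'rV[R]_n) : Prop :=
  [/\ open G, connected G & G !=set0].

Definition proper_domain (R : realType) (n : nat) (G : set 'rV[R]_n) : Prop :=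
  domain G /\ G != setT.

Definition boundary (T : topologicalType) (A : set T) : set T :=
  closure A `\` interior A.

(* [inf] is meaningful for proper domains, whose boundary is nonempty. *)
Definition bdist (R : realType) (n : nat) (G : set 'rV[R]_n) (x : 'rV[R]_n)
    : R :=
  inf [set enorm (x - y) | y in boundary G].

Definition hdist (R : realType) (n : nat) (G : set 'rV[R]_n) (c : R)
    (x y : 'rV[R]_n) : R :=
  ln (1 + c * (enorm (x - y) / Num.sqrt (bdist G x * bdist G y))).

(* [f] is total, but only its restriction to [G] matters: it is a homeomorphism
   from [G] onto [f @` G], both with the subspace topology. *)
Definition homeomorphism_on (T U : topologicalType) (G : set T) (f : T -> U)
    : Prop :=
  {within G, continuous f} /\
  exists g : U -> T,
    {in G, cancel f g} /\ {within f @` G, continuous g}.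

(* The pairs [(x, y)] of points of [G] with [|x - z| = |y - z| = r -> 0+]. *)
Definition equidistant_pairs (R : realType) (n : nat) (G : set 'rV[R]_n)
    (z : 'rV[R]_n) : set_system ('rV[R]_n * 'rV[R]_n) :=
  filter_from [set e : R | 0 < e]
    (fun e => [set p | [/\ G p.1, G p.2 &
       exists r : R, [/\ 0 < r < e, enorm (p.1 - z) = r & enorm (p.2 - z) = r]]]).

(* Both dilatations are extended reals, possibly [+oo]. *)
Definition dilatation_at (R : realType) (n : nat) (G : set 'rV[R]_n)
    (f : 'rV[R]_n -> 'rV[R]_n) (z : 'rV[R]_n) : \bar R :=
  limf_esup (fun p => (enorm (f p.1 - f z) / enorm (f p.2 - f z))%:E)
    (equidistant_pairs G z).

Definition dilatation (R : realType) (n : nat) (G : set 'rV[R]_n)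
    (f : 'rV[R]_n -> 'rV[R]_n) : \bar R :=
  ereal_sup [set dilatation_at G f z | z in G].

Definition quasiconformal (R : realType) (n : nat) (G : set 'rV[R]_n)
    (f : 'rV[R]_n -> 'rV[R]_n) : Prop :=
  homeomorphism_on G f /\ (dilatation G f < +oo)%E.

(* Main.v *)
(* As [x] tends to [z], [d_G(x)] tends to [d_G(z)] and [ln (1 + t)] is
   equivalent to [t], so the two bounds on [h] say that the stretching
   [|f x - f z| / |x - z|] lies asymptotically between [K / L] and [L * K],
   where [K = d_fG(f z) / d_G(z)]. Dividing the values at two points at the
   same distance from [z] cancels [K] and leaves [L ^ 2]. *)
Require Import Defs.
From mathcomp Require Import all_boot all_order all_algebra.
From mathcomp Require Import all_classical all_reals all_analysis.
From mathcomp Require Import ring lra.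
Import Order.TTheory GRing.Theory Num.Theory.
Import numFieldNormedType.Exports.
Local Open Scope classical_set_scope.
Local Open Scope ring_scope.

Set Implicit Arguments.
Unset Strict Implicit.

(** * The Euclidean norm and the topology it induces *)

Lemma sum_sqr_ge0 (R : realType) (n : nat) (x : 'rV[R]_n) :
  0 <= \sum_(i < n) x ord0 i ^+ 2.
Proof. by apply: sumr_ge0 => i _; exact: sqr_ge0. Qed.

Lemma enorm_ge0 (R : realType) (n : nat) (x : 'rV[R]_n) : 0 <= enorm x.
Proof. exact: sqrtr_ge0. Qed.

Lemma enorm_sqr (R : realType) (n : nat) (x : 'rV[R]_n) :
  enorm x ^+ 2 = \sum_(i < n) x ord0 i ^+ 2.
Proof. by rewrite sqr_sqrtr ?sum_sqr_ge0. Qed.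

Lemma enorm0 (R : realType) (n : nat) : enorm (0 : 'rV[R]_n) = 0.
Proof.
rewrite /enorm big1 ?sqrtr0 // => i _; by rewrite mxE expr0n.
Qed.

Lemma enormB (R : realType) (n : nat) (x y : 'rV[R]_n) :
  enorm (x - y) = enorm (y - x).
Proof.
by congr Num.sqrt; apply: eq_bigr => i _; rewrite !mxE -opprB sqrrN.
Qed.

Lemma normr_coord_le_enorm (R : realType) (n : nat) (x : 'rV[R]_n) (i : 'I_n) :
  `|x ord0 i| <= enorm x.
Proof.
rewrite -sqrtr_sqr ler_sqrt ?sum_sqr_ge0 // (bigD1 i) //= lerDl.
by apply: sumr_ge0 => j _; exact: sqr_ge0.
Qed.

Lemma enorm_eq0 (R : realType) (n : nat) (x : 'rV[R]_n) : enorm x = 0 -> x = 0.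
Proof.
move=> x0; apply/rowP => i; apply/eqP.
by rewrite mxE -normr_le0 -x0 normr_coord_le_enorm.
Qed.

(** Cauchy-Schwarz. With [a] and [b] the norms of [x] and [y], the nonnegative sum of the squares of
    [b * x_i - a * y_i] expands to [2ab(ab - s)], where [s] is the inner product. Cancelling [ab]
    requires both norms to be positive, so zero vectors are treated first. *)
Lemma dot_le_enorm (R : realType) (n : nat) (x y : 'rV[R]_n) :
  \sum_(i < n) x ord0 i * y ord0 i <= enorm x * enorm y.
Proof.
have [x0|xN0] := eqVneq (enorm x) 0.
  rewrite (enorm_eq0 x0) enorm0 mul0r big1 // => i _; by rewrite mxE mul0r.
have [y0|yN0] := eqVneq (enorm y) 0.
  rewrite (enorm_eq0 y0) enorm0 mulr0 big1 // => i _; by rewrite mxE mulr0.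
set a := enorm x in xN0 *; set b := enorm y in yN0 *.
have a0 : 0 < a by rewrite lt_def xN0 enorm_ge0.
have b0 : 0 < b by rewrite lt_def yN0 enorm_ge0.
have : 0 <= \sum_(i < n) (b * x ord0 i - a * y ord0 i) ^+ 2.
  by apply: sumr_ge0 => i _; exact: sqr_ge0.
have -> : \sum_(i < n) (b * x ord0 i - a * y ord0 i) ^+ 2 =
    b ^+ 2 * \sum_(i < n) x ord0 i ^+ 2 + a ^+ 2 * \sum_(i < n) y ord0 i ^+ 2
    - 2 * (a * b) * \sum_(i < n) x ord0 i * y ord0 i.
  rewrite !mulr_sumr -big_split -sumrB; apply: eq_bigr => i _ /=; ring.
rewrite -!enorm_sqr -/a -/b; set s := \sum_(i < n) _ => h.
rewrite -(ler_pM2l (mulr_gt0 a0 b0)); lra.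
Qed.

Lemma ler_enormD (R : realType) (n : nat) (x y : 'rV[R]_n) :
  enorm (x + y) <= enorm x + enorm y.
Proof.
rewrite -(@ler_pXn2r _ 2) ?nnegrE ?addr_ge0 ?enorm_ge0 // sqrrD !enorm_sqr.
have -> : \sum_(i < n) (x + y) ord0 i ^+ 2 = \sum_(i < n) x ord0 i ^+ 2
    + (\sum_(i < n) x ord0 i * y ord0 i) *+ 2 + \sum_(i < n) y ord0 i ^+ 2.
  rewrite -sumrMnl -!big_split; apply: eq_bigr => i _ /=; rewrite mxE; ring.
by rewrite lerD2r lerD2l lerMn2r dot_le_enorm orbT.
Qed.

Lemma continuous_enorm (R : realType) (n : nat) : continuous (@enorm R n).
Proof.
move=> x; apply: continuous_comp; last exact: sqrt_continuous.
pose F (i : 'I_n) (y : 'rV[R]_n) := y ord0 i ^+ 2 : R.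
apply: (@continuous_big R _ +%R 0 xpredT (@add_continuous R) _
  (index_enum 'I_n) F) => i _ y.
apply: (@continuous_comp _ _ _ (fun y : 'rV[R]_n => y ord0 i)
  (fun t => t ^+ 2)); first exact: coord_continuous.
exact: exprn_continuous.
Qed.

(** Each coordinate is bounded by the Euclidean norm, so a Euclidean ball lies in the sup-norm ball
    of the same radius. *)
Lemma nbhs_enormP (R : realType) (n : nat) (z : 'rV[R]_n)
    (P : set 'rV[R]_n) :
  nbhs z P -> exists2 e : R, 0 < e & forall x, enorm (x - z) < e -> P x.
Proof.
move=> /nbhs_ballP[e /= e0 zeP]; exists e => // x xze; apply: zeP.
split=> // i j; rewrite /ball /= (ord1 i).
apply: le_lt_trans xze; rewrite enormB.
by have := normr_coord_le_enorm (z - x) j; rewrite !mxE.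
Qed.

(** * The distance to the boundary: positive and continuous *)

Lemma boundary_nonempty (R : realType) (n : nat) (G : set 'rV[R]_n) :
  proper_domain G -> boundary G !=set0.
Proof.
move=> [[oG _ [z Gz]] GT]; apply/set0P/eqP => bG0; move/eqP: GT; apply.
(* An empty boundary makes the open set [G] closed as well. *)
have cG : closed G.
  move=> x clGx; apply: interior_subset; apply: contrapT => xNi.
  by have : boundary G x by []; rewrite bG0.
apply/seteqP; split => // w _.
(* The line from [z] to an arbitrary [w] pulls [G] back to a clopen subset of the reals containing
   0. The reals being connected, it also contains 1, and [p 1 = w]. *)
pose p (t : R) := z + t *: (w - z).
have cp : continuous p.
  move=> t; apply: cvgD; first exact: cvg_cst.
  by apply: cvgZr_tmp; exact: cvg_id.
have cR : connected [set: R] by apply/connected_intervalP.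
have pG : p @^-1` G = setT.
  apply: cR; first by exists 0; rewrite /= /p scale0r addr0.
    exists (p @^-1` G); last by rewrite setTI.
    by apply: open_comp => // t _; exact: cp.
  exists (p @^-1` G); last by rewrite setTI.
  by apply: preimage_closed => // t _; exact: cp.
have : (p @^-1` G) 1 by rewrite pG.
by rewrite /= /p scale1r subrKC.
Qed.

Lemma bdist_has_lbound (R : realType) (n : nat) (G : set 'rV[R]_n)
    (x : 'rV[R]_n) :
  has_lbound [set enorm (x - y) | y in boundary G].
Proof. by exists 0 => _ [y _ <-]; exact: enorm_ge0. Qed.

(** Take the infimum over boundary points [w] in [|x - w| <= |x - y| + |y - w|]. Used for both
    orders of [x] and [y], this makes [bdist G] 1-Lipschitz, hence continuous. *)
Lemma bdistB_le (R : realType) (n : nat) (G : set 'rV[R]_n)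
    (x y : 'rV[R]_n) :
  boundary G !=set0 -> bdist G x - bdist G y <= enorm (x - y).
Proof.
move=> [w0 bw0]; rewrite lerBlDr -lerBlDl.
apply: lb_le_inf; first by exists (enorm (y - w0)), w0.
move=> _ [w bw <-]; rewrite lerBlDl.
apply: (@le_trans _ _ (enorm (x - w))).
  by apply: ge_inf; [exact: bdist_has_lbound|exists w].
by have := ler_enormD (x - y) (y - w); rewrite subrKA.
Qed.

Lemma cvg_enormB (R : realType) (n : nat) (T : Type) (F : set_system T)
    (FF : Filter F) (f : T -> 'rV[R]_n) (a w : 'rV[R]_n) :
  f x @[x --> F] --> a -> enorm (f x - w) @[x --> F] --> enorm (a - w).
Proof.
move=> fa.
have fwa : f x - w @[x --> F] --> a - w by apply: cvgB => //; exact: cvg_cst.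
apply: (@cvg_comp _ _ _ (fun x => f x - w) (@enorm R n) F (nbhs (a - w))) => //.
exact: continuous_enorm.
Qed.

Lemma continuous_bdist (R : realType) (n : nat) (G : set 'rV[R]_n) :
  boundary G !=set0 -> continuous (bdist G).
Proof.
move=> bG z; suff: bdist G x @[x --> z] --> bdist G z by [].
have FF : Filter (nbhs z) by exact: nbhs_filter.
apply/(@cvgrPdist_lt _ _ _ (nbhs z) FF) => e e0.
have : enorm (x - z) @[x --> z] --> (0 : R).
  rewrite -(enorm0 R n) -(subrr z).
  by apply: (@cvg_enormB _ _ _ (nbhs z) _ (fun x => x)); exact: cvg_id.
move=> /cvgr_lt /(_ e e0); apply: filterS => x xze.
apply: le_lt_trans xze; rewrite ler_norml lerNl opprB bdistB_le //=.
by rewrite enormB bdistB_le.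
Qed.

(** Some Euclidean ball around [z] lies in [G], whereas boundary points of an open set lie outside
    it. The radius is thus a lower bound for the distances. *)
Lemma bdist_gt0 (R : realType) (n : nat) (G : set 'rV[R]_n) (z : 'rV[R]_n) :
  open G -> boundary G !=set0 -> G z -> 0 < bdist G z.
Proof.
move=> oG [w0 bw0] Gz.
have [e e0 zeG] := nbhs_enormP (open_nbhs_nbhs (conj oG Gz)).
apply: (lt_le_trans e0); apply: lb_le_inf; first by exists (enorm (z - w0)), w0.
move=> _ [w [_ nGw] <-]; rewrite leNgt; apply/negP => wze; apply: nGw.
by rewrite (interior_id _).1 //; apply: zeG; rewrite enormB.
Qed.

(** * From logarithmic to linear bounds *)

Lemma le_div1D_ln1D (R : realType) (t : R) :
  0 <= t -> t / (1 + t) <= ln (1 + t).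
Proof.
move=> t0; have t1 : 0 < 1 + t by rewrite ltr_pwDl.
rewrite -[leRHS]opprK -lnV ?posrE // lerNr.
(* After negation the claim is [ln (1 + u) <= u] at [u = - (t / (1 + t))]. *)
have e : (1 + t)^-1 = 1 + - (t / (1 + t)) by field; rewrite gt_eqF.
rewrite [X in ln X]e; apply: le_ln1Dx.
by rewrite ltrN2 ltr_pdivrMr // mul1r ltrDr.
Qed.

(** With [a = c * (s / T)] and [b = c * (r / S)], chain [a / (1 + a) <= ln (1 + a) <= L * ln (1 + b)
    <= L * b] and solve for [s]. The error factor [1 + a] tends to 1 when [s] tends to 0 and [T]
    stays away from 0. *)
Lemma ln1D_le_linear (R : realType) (c L S T r s : R) :
  0 < c -> 0 < L -> 0 < S -> 0 < T -> 0 <= r -> 0 <= s ->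
  ln (1 + c * (s / T)) <= L * ln (1 + c * (r / S)) ->
  s <= L * (1 + c * (s / T)) * (T / S) * r.
Proof.
move=> c0 L0 S0 T0 r0 s0 h.
have a0 : 0 <= c * (s / T) by rewrite mulr_ge0 ?divr_ge0 // ltW.
have b0 : 0 <= c * (r / S) by rewrite mulr_ge0 ?divr_ge0 // ltW.
have : c * (s / T) / (1 + c * (s / T)) <= L * (c * (r / S)).
  apply: le_trans (le_div1D_ln1D a0) (le_trans h _).
  by rewrite ler_pM2l // le_ln1Dx //; lra.
rewrite ler_pdivrMr ?ltr_pwDl // => {}h.
rewrite -(@ler_pM2l _ (c / T)) ?divr_gt0 //.
have -> : c / T * s = c * (s / T) by field; rewrite gt_eqF.
apply: (le_trans h); rewrite le_eqVlt; apply/orP; left; apply/eqP.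
by field; rewrite !gt_eqF.
Qed.

(** * The dilatation at a point *)

Lemma dilatation_at_le (R : realType) (n : nat) (c : R) (G : set 'rV[R]_n)
    (f : 'rV[R]_n -> 'rV[R]_n) (L : R) (z : 'rV[R]_n) :
  0 < c -> 1 <= L -> proper_domain G -> proper_domain (f @` G) ->
  {within G, continuous f} ->
  (forall x y : 'rV[R]_n, G x -> G y ->
     hdist G c x y / L <= hdist (f @` G) c (f x) (f y) <= L * hdist G c x y) ->
  G z -> (dilatation_at G f z <= (L ^+ 2)%:E)%E.
Proof.
move=> c0 L1 hG hfG cf hbilip Gz.
have L0 : 0 < L by exact: lt_le_trans L1.
have bG := boundary_nonempty hG; have bfG := boundary_nonempty hfG.
have [[oG _ _] _] := hG; have [[ofG _ _] _] := hfG.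
have cfz : {for z, continuous f}.
  by move: cf; rewrite continuous_open_subspace //; apply; rewrite inE.
have d0 x : G x -> 0 < bdist G x by exact: bdist_gt0.
have d'0 x : G x -> 0 < bdist (f @` G) (f x).
  by move=> Gx; apply: bdist_gt0 => //; exists x.
pose S x := Num.sqrt (bdist G x * bdist G z).
pose T x := Num.sqrt (bdist (f @` G) (f x) * bdist (f @` G) (f z)).
have S0 x : G x -> 0 < S x by move=> Gx; rewrite sqrtr_gt0 mulr_gt0 ?d0.
have T0 x : G x -> 0 < T x by move=> Gx; rewrite sqrtr_gt0 mulr_gt0 ?d'0.
pose r x := enorm (x - z); pose s x := enorm (f x - f z).
(* [U] bounds the stretching [s / r] and [V] its inverse [r / s]; one arises from the other by
   exchanging [(r, S)] with [(s, T)]. Both are continuous at [z]. *)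
pose U x := L * (1 + c * (s x / T x)) * (T x / S x).
pose V x := L * (1 + c * (r x / S x)) * (S x / T x).
have sU x : G x -> s x <= U x * r x.
  move=> Gx; apply: ln1D_le_linear; rewrite ?enorm_ge0 ?S0 ?T0 //.
  by have /andP[_] := hbilip x z Gx Gz.
have rV x : G x -> r x <= V x * s x.
  move=> Gx; apply: ln1D_le_linear; rewrite ?enorm_ge0 ?S0 ?T0 //.
  by have /andP[] := hbilip x z Gx Gz; rewrite ler_pdivrMr // mulrC.
have FF : Filter (nbhs z) by exact: nbhs_filter.
have csqrt (g : 'rV[R]_n -> R) a :
    g x @[x --> z] --> a -> Num.sqrt (g x) @[x --> z] --> Num.sqrt a.
  by move=> ga; apply: (cvg_comp _ _ ga); exact: sqrt_continuous.
have cS : S x @[x --> z] --> S z.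
  apply: csqrt; apply: cvgM; last exact: cvg_cst.
  exact: continuous_bdist.
have cT : T x @[x --> z] --> T z.
  apply: csqrt; apply: cvgM; last exact: cvg_cst.
  apply: (@cvg_comp _ _ _ f (bdist (f @` G)) _ (nbhs (f z))) => //.
  exact: continuous_bdist.
have cr : r x @[x --> z] --> r z.
  by apply: (@cvg_enormB _ _ _ (nbhs z) _ (fun x => x)); exact: cvg_id.
have cs : s x @[x --> z] --> s z by exact: cvg_enormB.
have SN0 : S z != 0 by rewrite gt_eqF ?S0.
have TN0 : T z != 0 by rewrite gt_eqF ?T0.
have cU : U x @[x --> z] --> U z.
  apply: cvgM; last by apply: cvgM => //; exact: cvgV.
  apply: cvgM; first exact: cvg_cst.
  apply: cvgD; first exact: cvg_cst.
  apply: cvgM; first exact: cvg_cst.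
  by apply: cvgM => //; exact: cvgV.
have cV : V x @[x --> z] --> V z.
  apply: cvgM; last by apply: cvgM => //; exact: cvgV.
  apply: cvgM; first exact: cvg_cst.
  apply: cvgD; first exact: cvg_cst.
  apply: cvgM; first exact: cvg_cst.
  by apply: cvgM => //; exact: cvgV.
(* At [z] the error factors equal 1, and the ratio [T z / S z] cancels in [U z * V z]. *)
have Uz : U z = L * (T z / S z).
  by rewrite /U /s subrr enorm0 mul0r mulr0 addr0 mulr1.
have Vz : V z = L * (S z / T z).
  by rewrite /V /r subrr enorm0 mul0r mulr0 addr0 mulr1.
have Uz0 : 0 < U z by rewrite Uz mulr_gt0 ?divr_gt0 ?S0 ?T0.
have Vz0 : 0 < V z by rewrite Vz mulr_gt0 ?divr_gt0 ?S0 ?T0.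
have UVz : U z * V z = L ^+ 2 by rewrite Uz Vz; field; rewrite SN0 TN0.
have L20 : 0 < L ^+ 2 by rewrite exprn_gt0.
apply/lee_addgt0Pr => e e0.
(* Near [z], each of [U] and [V] may exceed its value at [z] by a factor [m]. The choice of [m]
   makes the total loss exactly [e], since [m ^+ 2 * L ^+ 2 = L ^+ 2 + e]. *)
pose m := Num.sqrt (1 + e / L ^+ 2).
have m1 : 1 < m.
  by rewrite -sqrtr1 ltr_sqrt ?ltrDl ?divr_gt0 // addr_gt0 ?divr_gt0.
have mm : m ^+ 2 = 1 + e / L ^+ 2.
  by rewrite sqr_sqrtr // addr_ge0 ?divr_ge0 // ltW.
have /nbhs_enormP[k k0 kP] : \forall x \near z, U x < m * U z /\ V x < m * V z.
  by apply: filterI; [apply: (cvgr_lt _ cU)|apply: (cvgr_lt _ cV)];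
     rewrite ltr_pMl.
pose B : set ('rV[R]_n * 'rV[R]_n) := [set p | [/\ G p.1, G p.2 &
  exists t : R, [/\ 0 < t < k, enorm (p.1 - z) = t & enorm (p.2 - z) = t]]].
(* The upper limit is an infimum of suprema over the sets of the filter, so it suffices to bound the
   supremum over the pairs at radius less than [k]. *)
apply: ge_ereal_inf; exists (ereal_sup
  [set (enorm (f p.1 - f z) / enorm (f p.2 - f z))%:E | p in B]).
  by exists B => //; exists k.
apply: ge_ereal_sup => _ [[x y] /= [Gx Gy [t [/andP[t0 tk] xt yt]]] <-].
rewrite -EFinD lee_fin -/(s x) -/(s y).
have [Ux _] : U x < m * U z /\ V x < m * V z by apply: kP; rewrite xt.
have [_ Vy] : U y < m * U z /\ V y < m * V z by apply: kP; rewrite yt.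
have sx : s x <= m * U z * t.
  by apply: le_trans (sU x Gx) _; rewrite /r xt ler_pM2r // ltW.
have ty : t <= m * V z * s y.
  have := rV y Gy; rewrite /r yt => /le_trans; apply.
  by rewrite ler_wpM2r ?enorm_ge0 // ltW.
have m0 : 0 < m by exact: lt_trans m1.
have mV0 : 0 < m * V z by rewrite mulr_gt0.
(* Since [0 < t <= m * V z * s y], the denominator of the quotient is not zero and may be
   cleared. *)
have sy : 0 < s y by rewrite -(pmulr_rgt0 _ mV0) (lt_le_trans t0).
rewrite ler_pdivrMr //; apply: (le_trans sx).
(* The common radius [t] links the two points: [s x <= m * U z * t] and [t <= m * V z * s y]. *)
have -> : (L ^+ 2 + e) * s y = m * U z * (m * V z * s y).
  transitivity (m ^+ 2 * (U z * V z) * s y); last by ring.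
  by rewrite mm UVz; field; rewrite gt_eqF.
by rewrite ler_pM2l // mulr_gt0.
Qed.

Theorem theorem4p10 (R : realType) (n : nat) (hn : (2 <= n)%N)
  (c : R) (hc : 0 < c)
  (G : set 'rV[R]_n) (f : 'rV[R]_n -> 'rV[R]_n)
  (hG : proper_domain G) (hfG : proper_domain (f @` G))
  (hf : homeomorphism_on G f)
  (L : R) (hL : 1 <= L)
  (hbilip : forall x y : 'rV[R]_n, G x -> G y ->
     hdist G c x y / L <= hdist (f @` G) c (f x) (f y) <= L * hdist G c x y) :
  quasiconformal G f /\ (dilatation G f <= (L ^+ 2)%:E)%E.
Proof.
have hdil : (dilatation G f <= (L ^+ 2)%:E)%E.
  apply: ge_ereal_sup => _ [z Gz <-].
  by apply: (dilatation_at_le hc hL hG hfG) => //; case: hf.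
by split=> //; split=> //; exact: le_lt_trans hdil (ltry _).
Qed.
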